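(* Let $G=(V,E)$ be a finite graph with $|V|=n$. Then, for Lebesgue-almost every $Q\in\mathbb{R}^V$, the operator $H_Q=\Delta_G+Q$ satisfies Condition (I).
   Context: $G=(V,E)$ is a finite simple undirected graph, not necessarily connected, with $V=\{1,\dots,n\}$. Its combinatorial Laplacian is $\Delta_G u(j)=\sum_{k\sim j}(u(j)-u(k))$. A potential $Q\in\mathbb{R}^V$ is identified with the diagonal operator $(Qu)(j)=Q(j)u(j)$. Condition (I) for $H_Q$: if $(\phi_k)_{k=1}^n$ is a real orthonormal basis of eigenvectors of $H_Q$, the matrix $(\phi_k(j)^2)_{j,k=1}^n$ is invertible. *)

(* Defs.v *)
From HB Require Import structures.
From mathcomp Require Import all_boot all_order all_algebra.
From mathcomp Require Import all_classical all_reals all_analysis.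

Set Implicit Arguments.
Unset Strict Implicit.
Unset Printing Implicit Defensive.
Import Order.TTheory GRing.Theory Num.Theory.
Local Open Scope classical_set_scope.
Local Open Scope ring_scope.

Definition tuple_cons {T : Type} {n : nat} (p : T * n.-tuple T) :
  n.+1.-tuple T := [tuple of p.1 :: p.2].

Definition tuple_uncons {T : Type} {n : nat} (t : n.+1.-tuple T) :
  T * n.-tuple T := (thead t, [tuple of behead t]).

Lemma tuple_consK {T : Type} {n : nat} : cancel (@tuple_cons T n) tuple_uncons.
Proof. by move=> [x t]; congr pair; apply/val_inj. Qed.

Lemma tuple_unconsK {T : Type} {n : nat} : cancel (@tuple_uncons T n) tuple_cons.
Proof. by move=> t; rewrite [RHS]tuple_eta; apply/val_inj. Qed.

Lemma measurable_tuple_cons d (T : measurableType d) (n : nat) :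
  measurable_fun [set: T * n.-tuple T] tuple_cons.
Proof. exact: measurable_cons. Qed.

Lemma measurable_tuple_uncons d (T : measurableType d) (n : nat) :
  measurable_fun [set: n.+1.-tuple T] tuple_uncons.
Proof.
apply: measurable_fun_pair; last exact: measurable_behead.
exact: measurable_tnth.
Qed.

(* Lebesgue measure on R^n, carried by n.-tuple R with its product (that is,
   Borel) sigma-algebra: the n-fold product of the Lebesgue measure on R,
   transported along R * R^n ~ R^(n+1). *)
Fixpoint lebesgue_tuple {R : realType} (n : nat) :
    set (n.-tuple (measurableTypeR R)) -> \bar R :=
  match n with
  | 0 => \d_ ([tuple] : 0.-tuple (measurableTypeR R))
  | m.+1 => pushforward (lebesgue_measure \x @lebesgue_tuple R m)%E tuple_cons
  end.

Lemma lebesgue_tuple_ex {R : realType} (n : nat) :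
  exists mu : {sigma_finite_measure
    set (n.-tuple (measurableTypeR R)) -> \bar R},
    lebesgue_tuple (n := n) = mu.
Proof.
elim: n => [|n [mu E]].
  by exists \d_ ([tuple] : 0.-tuple (measurableTypeR R)).
have mC := @measurable_tuple_cons _ (measurableTypeR R) n.
pose nu : {measure set _ -> \bar R} := (lebesgue_measure \x mu)%E.
pose pm := measure_function_pushforward__canonical__measure_function_Measure nu mC.
have sf : sigma_finite setT pm.
  have /sigma_finiteP[F [FT ndF Foo]] := sigma_finiteT (@lebesgue_measure R).
  have /sigma_finiteP[G [GT ndG Goo]] := sigma_finiteT mu.
  exists (fun k => tuple_uncons @^-1` (F k `*` G k)).
    apply/seteqP; split=> // t _.
    have : [set: measurableTypeR R] (thead t) by [].
    rewrite FT => -[i _ Fi].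
    have : [set: n.-tuple (measurableTypeR R)] [tuple of behead t] by [].
    rewrite GT => -[j _ Gj].
    exists (maxn i j) => //; split => /=.
    - by move: Fi; exact/subsetPset/ndF/leq_maxl.
    - by move: Gj; exact/subsetPset/ndG/leq_maxr.
  move=> k; have [mF Fk] := Foo k; have [mG Gk] := Goo k; split.
    rewrite -[X in measurable X]setTI.
    by apply: measurable_tuple_uncons => //; exact: measurableX.
  rewrite /= /pushforward -comp_preimage.
  rewrite (_ : _ \o _ = id) ?preimage_id; last first.
    by apply/funext => p /=; rewrite tuple_consK.
  by rewrite product_measure1E// lte_mul_pinfty// ge0_fin_numE.
pose H := Measure_isSigmaFinite.Build _ _ _ pm sf.
pose mu' : {sigma_finite_measure set _ -> \bar R} := HB.pack (Measure.sort pm) H.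
by exists mu'; rewrite /= E.
Qed.

Lemma lebesgue_tuple0 {R : realType} (n : nat) :
  @lebesgue_tuple R n set0 = 0%E.
Proof. by have [mu ->] := @lebesgue_tuple_ex R n; exact: measure0. Qed.

Lemma lebesgue_tuple_ge0 {R : realType} (n : nat) A :
  (0 <= @lebesgue_tuple R n A)%E.
Proof. by have [mu ->] := @lebesgue_tuple_ex R n; exact: measure_ge0. Qed.

Lemma lebesgue_tuple_sigma_additive {R : realType} (n : nat) :
  semi_sigma_additive (@lebesgue_tuple R n).
Proof.
by have [mu ->] := @lebesgue_tuple_ex R n; exact: measure_semi_sigma_additive.
Qed.

HB.instance Definition _ (R : realType) (n : nat) :=
  isMeasure.Build _ _ _ (@lebesgue_tuple R n) (@lebesgue_tuple0 R n)
    (@lebesgue_tuple_ge0 R n) (@lebesgue_tuple_sigma_additive R n).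

Lemma lebesgue_tuple_sigma_finite {R : realType} (n : nat) :
  sigma_finite setT (@lebesgue_tuple R n).
Proof. by have [mu ->] := @lebesgue_tuple_ex R n; exact: sigma_finiteT. Qed.

HB.instance Definition _ (R : realType) (n : nat) :=
  Measure_isSigmaFinite.Build _ _ _ (@lebesgue_tuple R n)
    (@lebesgue_tuple_sigma_finite R n).

Lemma measurable_tuple_box d (T : measurableType d) (n : nat)
    (A : 'I_n -> set T) : (forall i, measurable (A i)) ->
  measurable [set t : n.-tuple T | forall i, A i (tnth t i)].
Proof.
move=> mA.
rewrite (_ : [set _ | _] = \bigcap_(i in [set: 'I_n]) ((@tnth _ T)^~ i @^-1` A i)).
  apply: fin_bigcap_measurable => // i _.
  by rewrite -[X in measurable X]setTI; apply: measurable_tnth.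
by apply/seteqP; split=> [t tA i _|t tA i]; exact: tA.
Qed.

Lemma lebesgue_tuple_box {R : realType} (n : nat)
    (A : 'I_n -> set (measurableTypeR R)) : (forall i, measurable (A i)) ->
  lebesgue_tuple [set t : n.-tuple _ | forall i, A i (tnth t i)] =
  (\prod_(i < n) lebesgue_measure (A i))%E.
Proof.
elim: n A => [|n IHn] A mA.
  by rewrite big_ord0 /= diracE mem_set//= => -[].
rewrite big_ord_recl -IHn => [|i]; last exact: mA.
have mB := @measurable_tuple_box _ (measurableTypeR R) n
  (fun i => A (lift ord0 i)) (fun i => mA (lift ord0 i)).
rewrite -product_measure1E//.
rewrite /= /pushforward; congr (_ _); apply/seteqP; split=> -[x t] /=.
- move=> xtA; split; first exact: (xtA ord0).
  by move=> i; have := xtA (lift ord0 i); rewrite tnthS.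
- move=> [Ax At] i; case: (unliftP ord0 i) => [j|] -> //.
  by rewrite tnthS.
Qed.

(* The vertex set is 'I_n, the graph is given by its adjacency relation e, and
   R^V is represented by column vectors. *)
Definition laplacian {R : realType} {n : nat} (e : rel 'I_n)
    (u : 'cV[R]_n) : 'cV[R]_n :=
  \col_j \sum_(k | e j k) (u j 0 - u k 0).

Definition potential {R : realType} {n : nat} (Q : n.-tuple R)
    (u : 'cV[R]_n) : 'cV[R]_n :=
  \col_j (tnth Q j * u j 0).

Definition schrodinger {R : realType} {n : nat} (e : rel 'I_n)
    (Q : n.-tuple R) (u : 'cV[R]_n) : 'cV[R]_n :=
  laplacian e u + potential Q u.

Definition eigenvector {R : realType} {n : nat} (H : 'cV[R]_n -> 'cV[R]_n)
    (u : 'cV[R]_n) : Prop :=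
  u != 0 /\ exists a : R, H u = a *: u.

Definition orthonormal_basis {R : realType} {n : nat}
    (phi : 'I_n -> 'cV[R]_n) : Prop :=
  basis_of {: 'cV[R]_n} [tuple phi k | k < n] /\
  forall k l, \sum_j phi k j 0 * phi l j 0 = (k == l)%:R.

(* Required of every eigenbasis: eigenbases are not unique when H has multiple
   eigenvalues. *)
Definition condition_I {R : realType} {n : nat}
    (H : 'cV[R]_n -> 'cV[R]_n) : Prop :=
  forall phi : 'I_n -> 'cV[R]_n,
    orthonormal_basis phi -> (forall k, eigenvector H (phi k)) ->
    \matrix_(j < n, k < n) (phi k j 0 ^+ 2) \in unitmx.

(* Main.v *)
Require Import Defs.
From mathcomp Require Import all_boot all_order all_algebra.
From mathcomp Require Import all_classical all_reals all_analysis.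
From mathcomp Require Import measurable_realfun.

(* Write M(A) for the n x n matrix with entries (A^m)_jj, m < n.  If H_Q has
   eigenvalues a_k with orthonormal eigenvectors phi_k, then
   (H_Q^m)_jj = \sum_k a_k^m phi_k(j)^2, so M(H_Q) is the product of the
   Vandermonde matrix of the a_k and the transpose of (phi_k(j)^2)_jk.
   Condition (I) therefore holds off the zero set of the polynomial
   Q |-> det M(H_Q).  This polynomial is not zero: for L = Delta_G and D diagonal
   with distinct entries, det M(sL + D) is a polynomial in s whose value at 0 is
   a nonzero Vandermonde determinant, and
   det M(L + D/s) = s^(-n(n-1)/2) det M(sL + D).  Finally, the zero set of a
   nonzero polynomial is Lebesgue null, by Fubini and induction on n. *)

Set Implicit Arguments.
Unset Strict Implicit.
Unset Printing Implicit Defensive.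
Import Order.TTheory GRing.Theory Num.Theory.
Local Open Scope classical_set_scope.
Local Open Scope ring_scope.

(** * Moment matrices and their Vandermonde factorisations *)

Definition moment_mx {R : pzRingType} {n : nat} (A : 'M[R]_n) : 'M[R]_n :=
  \matrix_(m, j) (A ^+ m) j j.

Lemma map_moment_mx (R S : pzRingType) (f : {rmorphism R -> S}) n
    (A : 'M[R]_n) : map_mx f (moment_mx A) = moment_mx (map_mx f A).
Proof. by apply/matrixP => m j; rewrite !mxE -rmorphXn mxE. Qed.

Lemma diag_mxX (R : comPzRingType) n (a : 'rV[R]_n) m :
  diag_mx a ^+ m = diag_mx (\row_j a 0 j ^+ m).
Proof.
elim: m => [|m IHm].
  by apply/matrixP => i j; rewrite expr0 !mxE.
rewrite exprS IHm; apply/matrixP => i j.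
by rewrite -[_ * _]/(_ *m _) mul_diag_mx !mxE exprS mulrnAr.
Qed.

Lemma moment_mx_diag (R : comPzRingType) n (a : 'rV[R]_n) :
  moment_mx (diag_mx a) = Vandermonde n a.
Proof. by apply/matrixP => m j; rewrite mxE diag_mxX !mxE eqxx. Qed.

Lemma moment_mxZ (R : comPzRingType) n (c : R) (A : 'M[R]_n) :
  moment_mx (c *: A) = diag_mx (\row_m c ^+ m) *m moment_mx A.
Proof.
have AX m : (c *: A) ^+ m = c ^+ m *: A ^+ m.
  elim: m => [|m IHm]; first by rewrite !expr0 scale1r.
  rewrite !exprS IHm -[LHS]/(_ *m _) -[in RHS]/(A *m A ^+ m).
  by rewrite -scalemxAl -scalemxAr scalerA.
by apply/matrixP => m j; rewrite mul_diag_mx !mxE AX mxE.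
Qed.

Lemma moment_mx_eigenbasis (R : comPzRingType) n (U : 'M[R]_n)
    (a : 'rV[R]_n) : U *m U^T = 1%:M ->
  moment_mx (U *m diag_mx a *m U^T) =
  Vandermonde n a *m (\matrix_(j, k) U j k ^+ 2)^T.
Proof.
move=> UU; have UV : U^T *m U = 1%:M by exact: mulmx1C.
have AX m : (U *m diag_mx a *m U^T) ^+ m = U *m diag_mx a ^+ m *m U^T.
  elim: m => [|m IHm]; first by rewrite !expr0 mulmx1 UU.
  rewrite !exprSr IHm -[LHS]/(_ *m _) -[_ ^+ m * _]/(_ *m _).
  by rewrite !mulmxA -(mulmxA _ U^T U) UV mulmx1.
apply/matrixP => m j; rewrite !mxE AX diag_mxX mul_mx_diag !mxE.
by apply: eq_bigr => k _; rewrite !mxE expr2 mulrA (mulrC (U j k)).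
Qed.

Lemma root_finite (R : idomainType) (p : {poly R}) :
  p != 0 -> finite_set [set x | root p x].
Proof.
move=> p0; apply: contrapT => /(infinite_set_fset (size p))[B Bp].
rewrite leqNgt => /negP; apply; apply: max_poly_roots => //; last exact: finmap.fset_uniq.
by apply/allP => x /Bp.
Qed.

Lemma exists_nonroot (R : numDomainType) (p : {poly R}) :
  p != 0 -> exists x, ~~ root p x.
Proof.
move=> p0; apply/not_existsP => h.
(* The integers below [size p] are [size p] distinct points, too many to be roots. *)
have := @max_poly_roots _ p [seq i%:R | i <- iota 0 (size p)] p0.
rewrite size_map size_iota ltnn => h'; suff: false by [].
apply: h'; first by apply/allP => x _; apply/negPn/negP/h.
by rewrite map_inj_uniq ?iota_uniq//; exact: mulrIn (oner_neq0 R).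
Qed.

Lemma moment_mx_perturb (R : numFieldType) n (L : 'M[R]_n) :
  exists Q : n.-tuple R,
    \det (moment_mx (L + diag_mx (\row_j tnth Q j))) != 0.
Proof.
pose D : 'rV[R]_n := \row_j (val j)%:R.
(* Over polynomials in s, with ['X] for s: [p] is det M(sL + D). *)
pose p := \det (moment_mx ('X *: map_mx polyC L + map_mx polyC (diag_mx D))).
have pE s : p.[s] = \det (moment_mx (s *: L + diag_mx D)).
  rewrite -horner_evalE -det_map_mx map_moment_mx map_mxD map_mxZ.
  rewrite -!map_mx_comp /= horner_evalE hornerX; congr (\det (moment_mx (_ *: _ + _)));
    by apply/matrixP => i j; rewrite !mxE /= horner_evalE hornerC.
have p0 : p.[0] != 0.
  rewrite pE scale0r add0r moment_mx_diag det_Vandermonde.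
  apply/prodf_neq0 => i _; apply/prodf_neq0 => j ij.
  by rewrite !mxE subr_eq0 eqr_nat gtn_eqF.
have pX0 : p * 'X != 0.
  (* The factor ['X] makes the nonroot s nonzero, so that D/s can serve as the potential. *)
  by rewrite mulf_neq0 ?polyX_eq0//; apply: contraNneq p0 => ->; rewrite horner0.
have [s] := exists_nonroot pX0.
rewrite rootM rootX negb_or rootE => /andP[ps s0].
exists [tuple s^-1 * (val j)%:R | j < n].
rewrite (_ : L + _ = s^-1 *: (s *: L + diag_mx D)).
  rewrite moment_mxZ det_mulmx mulf_neq0 -?pE// det_diag.
  by apply/prodf_neq0 => j _; rewrite mxE expf_neq0// invr_eq0.
rewrite scalerDr scalerA mulVf// scale1r; congr (_ + _).
by apply/matrixP => i j; rewrite !mxE tnth_mktuple -mulrnAr.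
Qed.

(** Expresses that a function is polynomial in each coordinate separately. This property passes to
    sections, so it suits the induction on n. *)
Definition tuple_upd {T : Type} {n : nat} (t : n.-tuple T) (i : 'I_n) (x : T) :
    n.-tuple T := [tuple if j == i then x else tnth t j | j < n].

Lemma tuple_upd_cons0 (T : Type) n (y : T) (t : n.-tuple T) x :
  tuple_upd (tuple_cons (y, t)) ord0 x = tuple_cons (x, t).
Proof.
apply: eq_from_tnth => i; rewrite tnth_mktuple.
by case: (unliftP ord0 i) => [j|] ->; rewrite ?eqxx// !tnthS.
Qed.

Lemma tuple_upd_consS (T : Type) n (y : T) (t : n.-tuple T) i x :
  tuple_upd (tuple_cons (y, t)) (lift ord0 i) x = tuple_cons (y, tuple_upd t i x).
Proof.
apply: eq_from_tnth => j; rewrite tnth_mktuple.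
case: (unliftP ord0 j) => [k|] ->; last by rewrite eq_liftF.
by rewrite !tnthS tnth_mktuple (inj_eq lift_inj).
Qed.

(* For a point t0 with f t0 != 0, the section at x of the zero set is null by
   induction unless x is one of the finitely many roots of f along the line
   through t0 in the first direction. *)
Lemma separately_polynomial_zero_null (R : realType) n
    (f : n.-tuple (measurableTypeR R) -> R) :
  measurable_fun setT f ->
  (forall t i, exists p : {poly R}, forall x, f (tuple_upd t i x) = p.[x]) ->
  (exists t, f t != 0) ->
  lebesgue_tuple [set t | f t = 0] = 0%E.
Proof.
elim: n f => [|n IHn] f mf pf [t0 ft0].
  (* R^0 is one point carrying a Dirac mass, and f does not vanish there. *)
  rewrite /= diracE memNset//= => /eqP; apply/negP.
  by rewrite [X in f X](_ : _ = t0)//; apply: val_inj; case: t0 {ft0} => -[].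
have mfc : measurable_fun setT (f \o tuple_cons).
  apply: measurableT_comp => //; exact: measurable_tuple_cons.
have mA : measurable [set xt : measurableTypeR R * n.-tuple (measurableTypeR R) |
    f (tuple_cons xt) = 0].
  rewrite -[X in measurable X]setTI; exact: mfc (measurable_set1 0).
have sec x : xsection [set xt | f (tuple_cons xt) = 0] x =
    [set t | f (tuple_cons (x, t)) = 0].
  by apply/seteqP; split=> t; rewrite /xsection /= inE.
have [p pE] := pf t0 ord0.
have p0 : p != 0.
  apply: contraNneq ft0 => p0; rewrite -(tuple_unconsK t0).
  have := pE (tuple_uncons t0).1; rewrite p0 horner0 -{1}(tuple_unconsK t0).
  by case: (tuple_uncons t0) => y t; rewrite tuple_upd_cons0 => ->.
have secNroot x : ~~ root p x ->
    lebesgue_tuple [set t | f (tuple_cons (x, t)) = 0] = 0%E.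
  move=> px; apply: IHn => [|t i|].
  - by apply: measurableT_comp mfc _; exact: pair1_measurable.
  - have [q qE] := pf (tuple_cons (x, t)) (lift ord0 i).
    by exists q => y; rewrite -qE tuple_upd_consS.
  - exists (tuple_uncons t0).2; move: px; rewrite rootE -pE.
    rewrite -{1}(tuple_unconsK t0).
    by case: (tuple_uncons t0) => y t; rewrite tuple_upd_cons0.
rewrite /= /pushforward /product_measure1 /=.
(* The integrand is the measure of the section at x, which is zero off the finite root set of
   [p]. *)
rewrite (ae_eq_integral (cst 0%E)) ?integral0//.
  exact: measurable_fun_xsection.
have croot := finite_set_countable (root_finite p0).
exists [set x | root p x]; split.
- by apply: countable_measurable.
- exact: countable_lebesgue_measure0.
- move=> x /=; apply: contra_notP => /negP px _.
  by rewrite sec secNroot.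
Qed.

(** The ring is general so that entries of the potential may be polynomials. *)
Definition schrodinger_mx {R : pzRingType} {n : nat} (e : rel 'I_n)
    (Q : 'rV[R]_n) : 'M[R]_n :=
  \matrix_(j, k) ((\sum_(l | e j l) 1) *+ (j == k) - (e j k)%:R) + diag_mx Q.

Lemma schrodingerE (R : realType) n (e : rel 'I_n) (Q : n.-tuple R) u :
  schrodinger e Q u = schrodinger_mx e (\row_j tnth Q j) *m u.
Proof.
rewrite /schrodinger /schrodinger_mx mulmxDl; congr (_ + _); last first.
  by apply/matrixP => j k; rewrite mul_diag_mx !mxE ord1.
apply/matrixP => j k; rewrite !mxE ord1 {k}.
under [RHS]eq_bigr do rewrite mxE mulrBl mulr_natl mulrnAl.
rewrite sumrB sumrB; congr (_ - _).
  rewrite [RHS](bigD1 j)//= eqxx mulr1n [X in _ + X]big1 ?addr0 => [|k kj].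
    by rewrite mulr_suml; apply: eq_bigr => k _; rewrite mul1r.
  by rewrite eq_sym (negPf kj) mulr0n.
by rewrite big_mkcond; apply: eq_bigr => k _; case: (e j k).
Qed.

(** Put ['X] at vertex i. Evaluation is a ring morphism, so it commutes with [moment_mx] and the
    determinant. *)
Lemma schrodinger_mx_upd (R : comNzRingType) n (e : rel 'I_n) (Q : n.-tuple R) i :
  exists A : 'M[{poly R}]_n, forall x,
    schrodinger_mx e (\row_j tnth (tuple_upd Q i x) j) =
    map_mx (horner_eval x) A.
Proof.
exists (schrodinger_mx e (\row_j if j == i then 'X else (tnth Q j)%:P)) => x.
apply/matrixP => j k; rewrite !mxE tnth_mktuple /horner_eval.
rewrite !(hornerD, hornerN, hornerMn) horner_sum (fun_if (horner^~ x)).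
by rewrite !hornerE.
Qed.

Lemma measurable_det_moment_mx (R : realType) d (T : measurableType d) n
    (A : T -> 'M[R]_n) :
  (forall i j, measurable_fun setT (fun t => A t i j)) ->
  measurable_fun setT (fun t => \det (moment_mx (A t))).
Proof.
move=> mA.
have mX m i j : measurable_fun setT (fun t => (A t ^+ m) i j).
  elim: m i j => [|m IHm] i j.
    by under eq_fun do rewrite expr0 mxE; exact: measurable_cst.
  under eq_fun do rewrite exprS -[_ * _]/(_ *m _) mxE.
  by apply: measurable_sum => k; exact: measurable_funM.
(* Leibniz formula for the determinant. *)
apply: measurable_sum => s; apply: measurable_funM; first exact: measurable_cst.
by apply: measurable_prod => i _; under eq_fun do rewrite mxE; exact: mX.
Qed.

(** The factorisation of M(A) holds for each orthonormal eigenbasis, with repeated eigenvalues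
    allowed, so all eigenbases are covered. *)
Lemma det_moment_mx_condition_I (R : realType) n (H : 'cV[R]_n -> 'cV[R]_n)
    (A : 'M[R]_n) : (forall u, H u = A *m u) ->
  \det (moment_mx A) != 0 -> condition_I H.
Proof.
move=> HA detA phi [_ ortho] eig.
have [a aP] := @boolp.choice _ _ (fun k c => H (phi k) = c *: phi k)
  (fun k => (eig k).2).
pose U : 'M[R]_n := \matrix_(j, k) phi k j 0.
have VU : U^T *m U = 1%:M.
  apply/matrixP => k l; rewrite !mxE -ortho.
  by apply: eq_bigr => j _; rewrite !mxE.
have UU := mulmx1C VU.
have AU : A *m U = U *m diag_mx (\row_k a k).
  apply/matrixP => j k; rewrite mul_mx_diag !mxE.
  have := congr1 (fun u : 'cV_n => u j 0) (aP k); rewrite HA !mxE mulrC => <-.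
  by apply: eq_bigr => l _; rewrite !mxE.
(* Here A = U diag(a) U^T, where the columns of U are the eigenvectors. *)
move: detA; rewrite -[A]mulmx1 -UU mulmxA AU moment_mx_eigenbasis//.
rewrite det_mulmx det_tr mulf_eq0 negb_or => /andP[_ P0].
rewrite unitmxE unitfE; congr (\det _ != 0): P0.
by apply/matrixP => j k; rewrite !mxE.
Qed.

Theorem proposition3p4 (R : realType) (n : nat) (e : rel 'I_n)
    (e_sym : symmetric e) (e_irr : irreflexive e) :
  {ae @lebesgue_tuple R n, forall Q, condition_I (schrodinger e Q)}.
Proof.
pose M (Q : n.-tuple R) := schrodinger_mx e (\row_j tnth Q j).
pose f (Q : n.-tuple (measurableTypeR R)) : R := \det (moment_mx (M Q)).
have mf : measurable_fun setT f.
  apply: measurable_det_moment_mx => i j.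
  under eq_fun do rewrite !mxE; apply: measurable_funD => //.
  case: (i == j); last exact: measurable_cst.
  exact: measurable_tnth.
exists [set Q | f Q = 0]; split.
- by rewrite -[X in measurable X]setTI; exact: mf (measurable_set1 0).
- apply: separately_polynomial_zero_null => // [t i|].
    have [A AE] := schrodinger_mx_upd e t i.
    exists (\det (moment_mx A)) => x.
    by rewrite /f /M AE -map_moment_mx det_map_mx.
  exact: moment_mx_perturb.
- move=> Q /=; apply: contra_notP => /eqP fQ.
  exact: det_moment_mx_condition_I (schrodingerE e Q) fQ.
Qed.
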